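(* Let $\mathbf C,\mathbf D$ be varieties. (1) For every $\mathbf C$-algebra $A$ there is a $\mathbf D$-coalgebra $R$ in $\mathbf C$ with a homomorphism $|R|\to A$ that is universal among $\mathbf D$-coalgebras with a homomorphism of their underlying algebra into $A$; i.e., the forgetful functor $\mathrm{Coalg}(\mathbf C,\mathbf D)\to\mathbf C$ has a right adjoint; equivalently, the functor $\mathrm{Rep}(\mathbf C,\mathbf D)\to\mathrm{Rep}(\mathbf C,\mathbf{Set})$ given by composition with $U_{\mathbf D}$ has a left adjoint. (2) More generally, let $\mathbf D'$ be any variety whose set of operation symbols is a subset of $\Omega_{\mathbf D}$ with arity function the restriction of that of $\mathbf D$ (no assumption on the identities of $\mathbf D'$). Then for every $\mathbf D'$-coalgebra $R'$ in $\mathbf C$ there is a $\mathbf D$-coalgebra $R$ in $\mathbf C$ with a homomorphism $|R|\to|R'|$ respecting the $\mathbf D'$-co-operations, universal among such.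
   Context: Varieties are specified by small sets of operation symbols ($\Omega_{\mathbf D}$ for $\mathbf D$) with cardinal arities $\mathrm{ari}(\alpha)$, and identities; $U_{\mathbf D}$ is the underlying-set functor. A $\mathbf D$-coalgebra $R$ in $\mathbf C$ is a $\mathbf C$-algebra $|R|$ with homomorphisms $\alpha^R:|R|\to\coprod_{\mathrm{ari}(\alpha)}|R|$ into copowers, $\alpha\in\Omega_{\mathbf D}$, such that every hom-set $\mathbf C(|R|,A)$ with operations induced by precomposition with the $\alpha^R$ satisfies the identities of $\mathbf D$. A homomorphism $h:|R|\to|R'|$ respects a co-operation $\alpha$ if $(\coprod_{\mathrm{ari}(\alpha)}h)\circ\alpha^R=\alpha^{R'}\circ h$. $\mathrm{Coalg}(\mathbf C,\mathbf D)$ is the category of $\mathbf D$-coalgebras in $\mathbf C$ with morphisms respecting all co-operations; $\mathrm{Rep}(\mathbf C,\mathbf D)$ is the full subcategory of $\mathbf{Cat}(\mathbf C,\mathbf D)$ of functors $\mathbf C(R,-)$, equivalent to the opposite of $\mathrm{Coalg}(\mathbf C,\mathbf D)$; $\mathrm{Rep}(\mathbf C,\mathbf{Set})$ is the category of representable set-valued functors on $\mathbf C$. *)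

(* Defs.v *)
Set Implicit Arguments.

Record signature := Sig { sym : Type; ari : sym -> Type }.

Inductive term (S : signature) (V : Type) : Type :=
| Var : V -> term S V
| App : forall a : sym S, (ari S a -> term S V) -> term S V.
Arguments Var {S V} _.
Arguments App {S V} _ _.

Fixpoint eval (S : signature) (T : Type) (ops : forall a : sym S, (ari S a -> T) -> T)
  (V : Type) (env : V -> T) (t : term S V) : T :=
  match t with
  | Var v => env v
  | App a ts => ops a (fun i => eval ops env (ts i))
  end.

Record theory (S : signature) := Theory {
  idx : Type;
  ivars : idx -> Type;
  lhs : forall i, term S (ivars i);
  rhs : forall i, term S (ivars i) }.

Record algebra (S : signature) (C : theory S) := Algebra {
  car : Type;
  ops : forall a : sym S, (ari S a -> car) -> car;
  alg_ax : forall (i : idx C) (e : ivars C i -> car),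
      eval ops e (lhs C i) = eval ops e (rhs C i) }.

Record hom (S : signature) (C : theory S) (A B : algebra C) := Hom {
  hfun :> car A -> car B;
  hmor : forall (a : sym S) (args : ari S a -> car A),
      hfun (ops A a args) = ops B a (fun i => hfun (args i)) }.

Definition hcomp (S : signature) (C : theory S) (A B E : algebra C)
  (g : hom B E) (f : hom A B) : hom A E.
Proof.
  refine (@Hom S C A E (fun x => g (f x)) _).
  intros a args. rewrite (hmor f), (hmor g). reflexivity.
Defined.

(* A D-coalgebra in C: a C-algebra |R| (= base), for each co-operation symbol
   a a copower of |R| indexed by ari a (object cop a, coprojections inj a,
   copairing copair a with its universal property), the co-operation
   coop a : |R| -> copower, and the requirement that every hom-set
   C(|R|, B), with operations f |-> copair a B f o coop a, satisfies the
   identities of D (equality of homomorphisms = equality of functions). *)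
Unset Implicit Arguments.
Record coalgebra (SC : signature) (C : theory SC) (SD : signature) (D : theory SD) :=
 Coalgebra {
  base : algebra C;
  cop : sym SD -> algebra C;
  inj : forall a, ari SD a -> hom base (cop a);
  copair : forall a (B : algebra C), (ari SD a -> hom base B) -> hom (cop a) B;
  copair_inj : forall a B (f : ari SD a -> hom base B) i x,
      copair a B f (inj a i x) = f i x;
  copair_uniq : forall a B (f : ari SD a -> hom base B) (k : hom (cop a) B),
      (forall i x, k (inj a i x) = f i x) -> forall y, k y = copair a B f y;
  coop : forall a, hom base (cop a);
  coalg_ax : forall (B : algebra C) (i : idx D) (env : ivars D i -> hom base B) x,
      eval (fun a f => hcomp (copair a B f) (coop a)) env (lhs D i) x
      = eval (fun a f => hcomp (copair a B f) (coop a)) env (rhs D i) x }.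

Set Implicit Arguments.
Arguments coalgebra {SC} C {SD} D.
Arguments base {SC C SD D} _.
Arguments cop {SC C SD D} _ _.
Arguments inj {SC C SD D} _ _ _.
Arguments copair {SC C SD D} _ _ _ _.
Arguments coop {SC C SD D} _ _.
(* h : |R1| -> |R2| respects the co-operation a1 of R1 / a2 of R2 (same arity):
   (coprod h) o a1^R1 = a2^R2 o h, where coprod h is the copower map with
   (coprod h) o inj_i = inj_i o h. *)
Definition respects_co (SC : signature) (C : theory SC)
  (SD1 : signature) (D1 : theory SD1) (SD2 : signature) (D2 : theory SD2)
  (R1 : coalgebra C D1) (R2 : coalgebra C D2) (h : hom (base R1) (base R2))
  (a1 : sym SD1) (a2 : sym SD2) (E : ari SD2 a2 = ari SD1 a1) : Prop :=
  exists k : hom (cop R1 a1) (cop R2 a2),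
    (forall (i : ari SD2 a2) x,
        k (inj R1 a1 (eq_rect _ (fun T => T) i _ E) x) = inj R2 a2 i (h x)) /\
    (forall x, k (coop R1 a1 x) = coop R2 a2 (h x)).

Definition coalg_mor (SC : signature) (C : theory SC) (SD : signature) (D : theory SD)
  (R1 R2 : coalgebra C D) (h : hom (base R1) (base R2)) : Prop :=
  forall a : sym SD, respects_co R1 R2 h a a eq_refl.

Definition sub_sig (S : signature) (P : sym S -> Prop) : signature :=
  Sig (fun a : {x : sym S | P x} => ari S (proj1_sig a)).

Definition respects_sub (SC : signature) (C : theory SC) (SD : signature) (D : theory SD)
  (P : sym SD -> Prop) (D' : theory (sub_sig SD P))
  (R : coalgebra C D) (R' : coalgebra C D') (h : hom (base R) (base R')) : Prop :=
  forall a' : {x : sym SD | P x}, respects_co R R' h (proj1_sig a') a' eq_refl.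

(* Main.v *)
(** A D-coalgebra structure on an algebra S can be recorded by choosing, for every co-operation a
    and element s, a term over ari a * S that evaluates to a(s) in the copower.  Together with a map
    into A, such data form a coalgebra for a polynomial functor on sets, so they map into its
    (weakly) final coalgebra, the set of possibly infinite "behaviours".  Let X be the set of those
    behaviours that arise from genuine D-coalgebras with a (suitable) homomorphism to A; no bound on
    the size of the coalgebras is needed.  Call a relation E on the free algebra on X stable if, in
    every algebra B, the maps X -> B compatible with E are closed under the induced operations and,
    for B = A, include the labelling X -> A.  The union of all stable relations is stable, and the
    algebra it presents is the cofree coalgebra: it is a D-coalgebra because X is covered by
    D-coalgebras, each of these maps to it, and two maps from the same coalgebra agree because the
    pairs of their values can be added to the maximal stable relation. *)
From Stdlib Require Import ClassicalEpsilon FunctionalExtensionality PropExtensionality ProofIrrelevance.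
Require Import Defs.

Set Implicit Arguments.

(** * Evaluation and substitution of terms *)

(** Taking [Q] to be the graph of a map makes the claim that this map commutes with [eval] an
    instance. *)
Lemma eval_rel (S : signature) (T1 T2 : Type)
  (ops1 : forall a : sym S, (ari S a -> T1) -> T1)
  (ops2 : forall a : sym S, (ari S a -> T2) -> T2) (Q : T1 -> T2 -> Prop)
  (HQ : forall a f1 f2, (forall i, Q (f1 i) (f2 i)) -> Q (ops1 a f1) (ops2 a f2))
  (V : Type) (e1 : V -> T1) (e2 : V -> T2) (He : forall v, Q (e1 v) (e2 v)) (t : term S V) :
  Q (eval ops1 e1 t) (eval ops2 e2 t).
Proof. induction t as [v|a ts IH]; simpl; auto. Qed.

Lemma eval_hom (S : signature) (C : theory S) (A B : algebra C) (h : hom A B) (V : Type)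
  (e : V -> car A) (t : term S V) :
  h (eval (ops A) e t) = eval (ops B) (fun v => h (e v)) t.
Proof.
  apply (eval_rel (ops A) (ops B) (fun x y => h x = y)); [|reflexivity].
  intros a f1 f2 H. rewrite (hmor h). f_equal. extensionality i. apply H.
Qed.

Lemma eval_ext (S : signature) (T : Type) (ops : forall a : sym S, (ari S a -> T) -> T)
  (V : Type) (e1 e2 : V -> T) (H : forall v, e1 v = e2 v) (t : term S V) :
  eval ops e1 t = eval ops e2 t.
Proof. f_equal. extensionality v. apply H. Qed.

Definition tmap {S : signature} {V W : Type} (g : V -> W) (t : term S V) : term S W :=
  eval (@App S W) (fun v => Var (g v)) t.

Lemma eval_subst (S : signature) (T : Type) (ops : forall a : sym S, (ari S a -> T) -> T)
  (V W : Type) (s : V -> term S W) (e : W -> T) (t : term S V) :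
  eval ops e (eval (@App S W) s t) = eval ops (fun v => eval ops e (s v)) t.
Proof.
  apply (eval_rel (@App S W) ops (fun x y => eval ops e x = y)); [|reflexivity].
  intros a f1 f2 H. simpl. f_equal. extensionality i. apply H.
Qed.

Lemma eval_tmap (S : signature) (T : Type) (ops : forall a : sym S, (ari S a -> T) -> T)
  (V W : Type) (g : V -> W) (e : W -> T) (t : term S V) :
  eval ops e (tmap g t) = eval ops (fun v => e (g v)) t.
Proof. apply eval_subst. Qed.

Lemma tmap_tmap (S : signature) (U V W : Type) (g : V -> W) (f : U -> V) (t : term S U) :
  tmap g (tmap f t) = tmap (fun u => g (f u)) t.
Proof. apply eval_tmap. Qed.

Definition satisfies {S : signature} {V T : Type} (ops : forall a : sym S, (ari S a -> T) -> T)
  (E : term S V -> term S V -> Prop) (u : V -> T) : Prop :=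
  forall s t, E s t -> eval ops u s = eval ops u t.

(** * Algebras presented by generators and relations *)

Section Presentation.
Context {SC : signature} (C : theory SC) {V : Type} (E : term SC V -> term SC V -> Prop).

(* Provable equality is replaced by truth in all models, which makes it a congruence for free. *)
Definition entails (s t : term SC V) : Prop :=
  forall (B : algebra C) (u : V -> car B),
    satisfies (ops B) E u -> eval (ops B) u s = eval (ops B) u t.

Definition pres_car : Type := {p : term SC V -> Prop | exists t, p = entails t}.

Definition cls (t : term SC V) : pres_car := exist _ (entails t) (ex_intro _ t eq_refl).

Lemma cls_eq (s t : term SC V) : entails s t -> cls s = cls t.
Proof.
  intros H. apply subset_eq_compat. extensionality r. apply propositional_extensionality.
  split; intros K B u Hu; rewrite <- (K B u Hu); [symmetry|]; exact (H B u Hu).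
Qed.

Lemma cls_surj (q : pres_car) : exists t, cls t = q.
Proof. destruct q as [p [t ->]]. exists t. reflexivity. Qed.

(** Arities may be infinite, so operations on classes need a simultaneous choice of
    representatives. *)
Definition rep (q : pres_car) : term SC V :=
  proj1_sig (constructive_indefinite_description _ (cls_surj q)).

Lemma cls_rep (q : pres_car) : cls (rep q) = q.
Proof. exact (proj2_sig (constructive_indefinite_description _ (cls_surj q))). Qed.

Lemma rep_cls (t : term SC V) : entails (rep (cls t)) t.
Proof.
  assert (H : entails (rep (cls t)) = entails t)
    by exact (f_equal (@proj1_sig _ _) (cls_rep (cls t))).
  rewrite H. intros B u _. reflexivity.
Qed.

Definition pres_ops (a : sym SC) (args : ari SC a -> pres_car) : pres_car :=
  cls (App a (fun i => rep (args i))).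

Lemma pres_ops_cls (a : sym SC) (ts : ari SC a -> term SC V) :
  pres_ops a (fun i => cls (ts i)) = cls (App a ts).
Proof.
  apply cls_eq. intros B u Hu. simpl. f_equal. extensionality i. exact (rep_cls (ts i) B Hu).
Qed.

Lemma eval_cls (W : Type) (s : W -> term SC V) (t : term SC W) :
  eval pres_ops (fun w => cls (s w)) t = cls (eval (@App SC V) s t).
Proof.
  apply (eval_rel pres_ops (@App SC V) (fun x y => x = cls y)); [|reflexivity].
  intros a f1 f2 H. rewrite <- pres_ops_cls. f_equal. extensionality i. apply H.
Qed.

Definition pres : algebra C.
Proof.
  refine (Algebra C pres_ops _). intros i e.
  (* With the environment written through representatives, the identity becomes an entailment
     between substituted terms, true in every algebra by its axioms. *)
  assert (He : e = fun v => cls (rep (e v))) by (extensionality v; now rewrite cls_rep).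
  rewrite He, !eval_cls. apply cls_eq. intros B u _.
  rewrite !eval_subst. apply alg_ax.
Defined.

Definition gen (v : V) : car pres := cls (Var v).

Lemma eval_gen (t : term SC V) : eval (ops pres) gen t = cls t.
Proof.
  unfold gen. simpl. rewrite eval_cls. f_equal.
  induction t as [v|a ts IH]; simpl; [|f_equal; extensionality i]; auto.
Qed.

Lemma gen_surj (q : car pres) : exists t, q = eval (ops pres) gen t.
Proof. exists (rep q). rewrite eval_gen. symmetry. apply cls_rep. Qed.

Lemma gen_satisfies : satisfies (ops pres) E gen.
Proof.
  intros s t H. rewrite !eval_gen. apply cls_eq. intros B u Hu. exact (Hu s t H).
Qed.

Definition lift {B : algebra C} (u : V -> car B) (Hu : satisfies (ops B) E u) : hom pres B.
Proof.
  refine (Hom pres B (fun q => eval (ops B) u (rep q)) _).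
  intros a args. exact (rep_cls (App a (fun i => rep (args i))) B Hu).
Defined.

Lemma lift_gen (B : algebra C) (u : V -> car B) (Hu : satisfies (ops B) E u) (v : V) :
  lift Hu (gen v) = u v.
Proof. exact (rep_cls (Var v) B Hu). Qed.

Lemma pres_hom_ext (B : algebra C) (h k : hom pres B) :
  (forall v, h (gen v) = k (gen v)) -> forall q, h q = k q.
Proof.
  intros H q. destruct (gen_surj q) as [t ->]. rewrite !eval_hom. apply eval_ext, H.
Qed.

Lemma hom_gen_satisfies (B : algebra C) (h : hom pres B) :
  satisfies (ops B) E (fun v => h (gen v)).
Proof.
  intros s t H. rewrite <- !eval_hom. f_equal. apply gen_satisfies, H.
Qed.

End Presentation.

(* A map [tau a : X -> term SC (ari SD a * X)], read as a co-operation on the free algebra on X,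
   turns the set of maps X -> B into an SD-algebra. *)
Definition dual_op {SC : signature} {C : theory SC} {SD : signature} {X : Type}
  (tau : forall a : sym SD, X -> term SC (ari SD a * X)) (B : algebra C)
  (a : sym SD) (u : ari SD a -> X -> car B) (x : X) : car B :=
  eval (ops B) (fun p => u (fst p) (snd p)) (tau a x).

(** * Coalgebra structure on a presented algebra *)

Section PresentedCoalgebra.
Context {SC : signature} {C : theory SC} {SD : signature} {D : theory SD} {X : Type}
  (tau : forall a : sym SD, X -> term SC (ari SD a * X)) (E : term SC X -> term SC X -> Prop).

(** Maps satisfying [E] correspond to homomorphisms out of [pres C E], so the operations [dual_op]
    restrict to these hom-sets. *)
Hypothesis stable : forall (B : algebra C) a (u : ari SD a -> X -> car B),
  (forall i, satisfies (ops B) E (u i)) -> satisfies (ops B) E (dual_op tau B a u).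

Hypothesis identities : forall (B : algebra C) (i : idx D) (env : ivars D i -> X -> car B),
  (forall v, satisfies (ops B) E (env v)) ->
  forall x, eval (dual_op tau B) env (lhs D i) x = eval (dual_op tau B) env (rhs D i) x.

(** One copy of the relations [E] for each index, on disjoint copies of the generators. *)
Definition copower_rel (I : Type) (s t : term SC (I * X)) : Prop :=
  exists i s0 t0, E s0 t0 /\ s = tmap (pair i) s0 /\ t = tmap (pair i) t0.

Lemma copower_satisfies (I : Type) (B : algebra C) (u : I -> X -> car B) :
  (forall i, satisfies (ops B) E (u i)) ->
  satisfies (ops B) (@copower_rel I) (fun p => u (fst p) (snd p)).
Proof.
  intros H s t (i & s0 & t0 & H0 & -> & ->). rewrite !eval_tmap. exact (H i s0 t0 H0).
Qed.

Definition copower (I : Type) : algebra C := pres C (@copower_rel I).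

Lemma coproj_satisfies (I : Type) (i : I) :
  satisfies (ops (copower I)) E (fun x => gen C (@copower_rel I) (i, x)).
Proof.
  intros s t H. rewrite <- !(eval_tmap _ (pair i)). apply gen_satisfies.
  exists i, s, t. auto.
Qed.

Definition coproj (I : Type) (i : I) : hom (pres C E) (copower I) := lift (coproj_satisfies i).

Definition cotuple (I : Type) (B : algebra C) (f : I -> hom (pres C E) B) : hom (copower I) B :=
  lift (copower_satisfies B (fun i x => f i (gen C E x)) (fun i => hom_gen_satisfies (f i))).

(** As in the Yoneda lemma, the co-operation is the induced operation applied to the tuple of
    coprojections. *)
Definition pres_coop (a : sym SD) : hom (pres C E) (copower (ari SD a)) :=
  lift (stable (copower (ari SD a)) a _ (@coproj_satisfies (ari SD a))).

Lemma coproj_gen (I : Type) (i : I) (x : X) :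
  coproj i (gen C E x) = gen C (@copower_rel I) (i, x).
Proof. exact (lift_gen _ (coproj_satisfies i) x). Qed.

Lemma cotuple_gen (I : Type) (B : algebra C) (f : I -> hom (pres C E) B) (p : I * X) :
  cotuple f (gen C (@copower_rel I) p) = f (fst p) (gen C E (snd p)).
Proof.
  exact (lift_gen _ (copower_satisfies B _ (fun i => hom_gen_satisfies (f i))) p).
Qed.

Lemma pres_coop_gen (a : sym SD) (x : X) :
  pres_coop a (gen C E x) = eval (ops (copower (ari SD a))) (gen C (@copower_rel (ari SD a))) (tau a x).
Proof.
  etransitivity;
    [exact (lift_gen _ (stable _ _ _ (@coproj_satisfies (ari SD a))) x)|]. apply eval_ext. intros [i y]. reflexivity.
Qed.

Lemma cotuple_coproj (I : Type) (B : algebra C) (f : I -> hom (pres C E) B) i q :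
  cotuple f (coproj i q) = f i q.
Proof.
  apply (pres_hom_ext (hcomp (cotuple f) (coproj i)) (f i)). intros x.
  change (cotuple f (coproj i (gen C E x)) = f i (gen C E x)).
  rewrite coproj_gen. apply cotuple_gen.
Qed.

Lemma cotuple_uniq (I : Type) (B : algebra C) (f : I -> hom (pres C E) B) (k : hom (copower I) B) :
  (forall i q, k (coproj i q) = f i q) -> forall q, k q = cotuple f q.
Proof.
  intros H. apply pres_hom_ext. intros [i x].
  transitivity (f i (gen C E x)); [|symmetry; exact (cotuple_gen f (i, x))].
  rewrite <- H. now rewrite coproj_gen.
Qed.

Lemma cotuple_coop (a : sym SD) (B : algebra C) (f : ari SD a -> hom (pres C E) B) (x : X) :
  cotuple f (pres_coop a (gen C E x)) = dual_op tau B a (fun i y => f i (gen C E y)) x.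
Proof.
  rewrite pres_coop_gen, eval_hom. apply eval_ext. intros p. apply cotuple_gen.
Qed.

Lemma eval_cotuple_coop (B : algebra C) (V : Type) (env : V -> hom (pres C E) B) (t : term SD V) :
  forall x, eval (fun a f => hcomp (cotuple f) (pres_coop a)) env t (gen C E x)
            = eval (dual_op tau B) (fun v y => env v (gen C E y)) t x.
Proof.
  apply (eval_rel (fun a f => hcomp (cotuple f) (pres_coop a)) (dual_op tau B)
           (fun h u => forall x, h (gen C E x) = u x)); [|reflexivity].
  intros a f1 f2 H x.
  change (cotuple f1 (pres_coop a (gen C E x)) = dual_op tau B a f2 x). rewrite cotuple_coop. unfold dual_op. apply eval_ext.
  intros [i y]. apply H.
Qed.

Definition pres_coalg : coalgebra C D.
Proof.
  refine (Coalgebra SC C SD D (pres C E) (fun a => copower (ari SD a)) (fun a => @coproj (ari SD a))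
            (fun a => @cotuple (ari SD a)) (fun a => @cotuple_coproj (ari SD a)) (fun a => @cotuple_uniq (ari SD a))
            pres_coop _).
  intros B i env. apply pres_hom_ext. intros x. rewrite !eval_cotuple_coop.
  apply identities. intros v. apply hom_gen_satisfies.
Defined.

End PresentedCoalgebra.

(** * Terms representing the co-operations of a coalgebra *)

Section Coterms.
Context {SC : signature} {C : theory SC} {SD : signature} {D : theory SD} (S : coalgebra C D).

(** The copower is known only through its universal property. Values of terms in the coprojections
    form a subalgebra [I]; copairing into [I] followed by inclusion is the identity by uniqueness,
    so [I] is everything. *)
Lemma copower_generated (a : sym SD) (y : car (cop S a)) :
  exists t : term SC (ari SD a * car (base S)),
    eval (ops (cop S a)) (fun p => inj S a (fst p) (snd p)) t = y.
Proof.
  set (ev := eval (ops (cop S a)) (fun p => inj S a (fst p) (snd p))).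
  set (im := fun y => exists t, ev t = y).
  assert (im_ops : forall b (args : ari SC b -> {y | im y}),
             im (ops (cop S a) b (fun i => proj1_sig (args i)))).
  { intros b args.
    assert (H : forall i, exists t, ev t = proj1_sig (args i)) by (intros i; apply proj2_sig).
    exists (App b (fun i => proj1_sig (constructive_indefinite_description _ (H i)))).
    unfold ev; simpl. f_equal. extensionality i.
    exact (proj2_sig (constructive_indefinite_description _ (H i))). }
  set (iops := fun b args => exist im _ (im_ops b args)).
  assert (val_eval : forall V (e : V -> {y | im y}) t,
             proj1_sig (eval iops e t) = eval (ops (cop S a)) (fun v => proj1_sig (e v)) t).
  { intros V e t.
    apply (eval_rel iops (ops (cop S a)) (fun x y => proj1_sig x = y)); [|reflexivity].
    intros b f1 f2 H. simpl. f_equal. extensionality i. apply H. }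
  assert (im_ax : forall i (e : ivars C i -> {y | im y}),
             eval iops e (lhs C i) = eval iops e (rhs C i)).
  { intros i e. apply eq_sig_hprop; [intros; apply proof_irrelevance|].
    rewrite !val_eval. apply alg_ax. }
  set (I := Algebra C iops im_ax).
  assert (im_inj : forall i x, im (inj S a i x)) by (intros i x; exists (Var (i, x)); reflexivity).
  assert (inj_mor : forall i b (args : ari SC b -> car (base S)),
             exist im _ (im_inj i (ops (base S) b args))
             = ops I b (fun j => exist im _ (im_inj i (args j)))).
  { intros i b args. apply eq_sig_hprop; [intros; apply proof_irrelevance|]. apply hmor. }
  set (p := copair S a I (fun i => Hom (base S) I (fun x => exist im _ (im_inj i x)) (inj_mor i))).
  set (val := Hom I (cop S a) (@proj1_sig _ im) (fun b args => eq_refl)).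
  set (idh := Hom (cop S a) (cop S a) (fun y => y) (fun b args => eq_refl)).
  assert (H : hcomp val p y = idh y).
  { transitivity (copair S a (cop S a) (inj S a) y).
    - apply copair_uniq. intros i x.
      change (proj1_sig (p (inj S a i x)) = inj S a i x). unfold p. rewrite copair_inj. reflexivity.
    - symmetry. apply copair_uniq. reflexivity. }
  simpl in H. rewrite <- H. exact (proj2_sig (p y)).
Qed.

Definition coterm (a : sym SD) (s : car (base S)) : term SC (ari SD a * car (base S)) :=
  proj1_sig (constructive_indefinite_description _ (copower_generated a (coop S a s))).

Lemma eval_coterm (a : sym SD) (s : car (base S)) :
  eval (ops (cop S a)) (fun p => inj S a (fst p) (snd p)) (coterm a s) = coop S a s.
Proof.
  exact (proj2_sig (constructive_indefinite_description _ (copower_generated a (coop S a s)))).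
Qed.

Lemma hom_coop (a : sym SD) (B : algebra C) (k : hom (cop S a) B) (s : car (base S)) :
  k (coop S a s) = dual_op coterm B a (fun i x => k (inj S a i x)) s.
Proof. rewrite <- eval_coterm. apply eval_hom. Qed.

Lemma copair_coop (a : sym SD) (B : algebra C) (f : ari SD a -> hom (base S) B) s :
  copair S a B f (coop S a s) = dual_op coterm B a (fun i => f i) s.
Proof.
  rewrite hom_coop. apply eval_ext. intros [i x]. apply copair_inj.
Qed.

End Coterms.

(** * Behaviours and corecursion *)

(** Occurrences of variables: the positions of the polynomial functor sending [X] to
    [term S (I * X)], whose shapes are [term S I]. *)
Fixpoint pos {S : signature} {V : Type} (t : term S V) : Type :=
  match t with
  | Var _ => unit
  | App a ts => {i : ari S a & pos (ts i)}
  end.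

Fixpoint fill {S : signature} {I X : Type} (t : term S I) : (pos t -> X) -> term S (I * X) :=
  match t with
  | Var i => fun k => Var (i, k tt)
  | App a ts => fun k => App a (fun j => fill (ts j) (fun p => k (existT _ j p)))
  end.

Fixpoint content {S : signature} {I X : Type} (t : term S (I * X)) : pos (tmap fst t) -> X :=
  match t with
  | Var p => fun _ => snd p
  | App a ts => fun q => content (ts (projT1 q)) (projT2 q)
  end.

Lemma fill_content (S : signature) (I X Y : Type) (g : X -> Y) (t : term S (I * X)) :
  fill (tmap fst t) (fun p => g (content t p)) = tmap (fun p => (fst p, g (snd p))) t.
Proof.
  induction t as [[i x]|a ts IH]; [reflexivity|].
  unfold tmap; simpl. f_equal. extensionality j. apply IH.
Qed.

(* A coinductive type with a field [forall a, term SC (ari SD a * behaviour)] would not admit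
   a guarded corecursor, whence the split of terms into a shape and a filling of its positions. *)
CoInductive behaviour {SC SD : signature} {T : Type} : Type :=
  Behaviour {
    output : T;
    shape : forall a : sym SD, term SC (ari SD a);
    next : forall a : sym SD, pos (shape a) -> behaviour }.
Arguments behaviour : clear implicits.

Section Behaviour.
Context {SC SD : signature} {T : Type}.

Definition unfolding (a : sym SD) (x : behaviour SC SD T) :
  term SC (ari SD a * behaviour SC SD T) := fill (shape x a) (next x a).

CoFixpoint behave {X : Type} (f : X -> T)
  (tau : forall a : sym SD, X -> term SC (ari SD a * X)) (x : X) : behaviour SC SD T :=
  Behaviour (f x) (fun a => tmap fst (tau a x))
    (fun a p => behave f tau (content (tau a x) p)).

Lemma unfolding_behave (X : Type) (f : X -> T) (tau : forall a, X -> term SC (ari SD a * X)) a x :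
  unfolding a (behave f tau x) = tmap (fun p => (fst p, behave f tau (snd p))) (tau a x).
Proof. apply fill_content. Qed.

End Behaviour.

(** * Stable relations and the cofree coalgebra *)

Section Cofree.
Context {SC : signature} {C : theory SC} {SD : signature} {D : theory SD}
  {P : sym SD -> Prop} {D' : theory (sub_sig SD P)} (R' : coalgebra C D').

Let A : algebra C := base R'.

Definition trace (S : coalgebra C D) (f : hom (base S) A) : car (base S) -> behaviour SC SD (car A) :=
  behave f (coterm S).

(* The behaviours of actual coalgebras over R': these form a set, although the coalgebras do not. *)
Definition realized (b : behaviour SC SD (car A)) : Prop :=
  exists (S : coalgebra C D) (f : hom (base S) A), respects_sub S R' f /\ exists s, b = trace S f s.

Definition state : Type := {b | realized b}.

Definition retract (x0 : state) (b : behaviour SC SD (car A)) : state :=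
  match excluded_middle_informative (realized b) with
  | left H => exist _ b H
  | right _ => x0
  end.

Lemma retract_val (x0 x : state) : retract x0 (proj1_sig x) = x.
Proof.
  unfold retract. destruct (excluded_middle_informative _) as [H|H].
  - apply eq_sig_hprop; [intros; apply proof_irrelevance|reflexivity].
  - destruct (H (proj2_sig x)).
Qed.

(* Successors of realized behaviours are realized, so the retraction changes nothing. *)
Definition step (a : sym SD) (x : state) : term SC (ari SD a * state) :=
  tmap (fun p => (fst p, retract x (snd p))) (unfolding a (proj1_sig x)).

Definition label (x : state) : car A := output (proj1_sig x).

Section Trace.
Variables (S : coalgebra C D) (f : hom (base S) A) (Hf : respects_sub S R' f).

Definition st (s : car (base S)) : state :=
  exist _ (trace S f s) (ex_intro _ S (ex_intro _ f (conj Hf (ex_intro _ s eq_refl)))).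

Lemma step_st (a : sym SD) (s : car (base S)) :
  step a (st s) = tmap (fun p => (fst p, st (snd p))) (coterm S a s).
Proof.
  unfold step. simpl. unfold trace. rewrite unfolding_behave, tmap_tmap. simpl.
  f_equal. extensionality p. f_equal. exact (retract_val (st s) (st (snd p))).
Qed.

Lemma dual_op_st (B : algebra C) (a : sym SD) (u : ari SD a -> state -> car B) s :
  dual_op step B a u (st s) = dual_op (coterm S) B a (fun i x => u i (st x)) s.
Proof. unfold dual_op. rewrite step_st. apply eval_tmap. Qed.

End Trace.

(** This reduces claims about states to claims about genuine coalgebras over [R']. *)
Lemma state_st (x : state) : exists S f (Hf : respects_sub S R' f) s, x = st Hf s.
Proof.
  destruct x as [b Hb]. destruct Hb as (S & f & Hf & s & ->) eqn:E.
  exists S, f, Hf, s. apply eq_sig_hprop; [intros; apply proof_irrelevance|reflexivity].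
Qed.

Definition stable_rel (E : term SC state -> term SC state -> Prop) : Prop :=
  satisfies (ops A) E label /\
  forall (B : algebra C) a (u : ari SD a -> state -> car B),
    (forall i, satisfies (ops B) E (u i)) -> satisfies (ops B) E (dual_op step B a u).

Definition max_rel (s t : term SC state) : Prop := exists E, stable_rel E /\ E s t.

Lemma max_rel_satisfies E (B : algebra C) (u : state -> car B) :
  stable_rel E -> satisfies (ops B) max_rel u -> satisfies (ops B) E u.
Proof. intros HE Hu s t H. apply Hu. exists E. auto. Qed.

Lemma max_rel_stable : stable_rel max_rel.
Proof.
  split.
  - intros s t (E & HE & H). exact (proj1 HE s t H).
  - intros B a u Hu s t (E & HE & H). refine (proj2 HE B a u _ s t H).
    intros i. apply (max_rel_satisfies B HE), Hu.
Qed.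

(** Exactly the relations that [u] must satisfy for its composite with [st Hf] to be a
    homomorphism. *)
Definition trace_rel S f (Hf : respects_sub S R' f) (s t : term SC state) : Prop :=
  exists a args, s = Var (st Hf (ops (base S) a args)) /\ t = App a (fun j => Var (st Hf (args j))).

Definition trace_hom S f (Hf : respects_sub S R' f) (B : algebra C) (u : state -> car B)
  (Hu : satisfies (ops B) (trace_rel Hf) u) : hom (base S) B :=
  Hom (base S) B (fun s => u (st Hf s))
    (fun a args => Hu _ _ (ex_intro _ a (ex_intro _ args (conj eq_refl eq_refl)))).

Lemma hom_trace_satisfies S f (Hf : respects_sub S R' f) (B : algebra C) (u : state -> car B)
  (h : hom (base S) B) :
  (forall s, u (st Hf s) = h s) -> satisfies (ops B) (trace_rel Hf) u.
Proof.
  intros H s t (a & args & -> & ->). simpl. rewrite H, hmor. f_equal. extensionality j.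
  symmetry. apply H.
Qed.

(** Along [st Hf] the labelling restricts to [f], and [dual_op step] to the operation that [S]
    induces on homomorphisms, which again yields a homomorphism. *)
Lemma trace_rel_stable S f (Hf : respects_sub S R' f) : stable_rel (trace_rel Hf).
Proof.
  split.
  - apply (@hom_trace_satisfies _ _ Hf A label f). reflexivity.
  - intros B a u Hu.
    apply (@hom_trace_satisfies _ _ Hf B _
             (hcomp (copair S a B (fun i => trace_hom B (Hu i))) (coop S a))).
    intros s. rewrite dual_op_st. simpl. rewrite copair_coop. reflexivity.
Qed.

Lemma max_trace S f (Hf : respects_sub S R' f) (B : algebra C) (u : state -> car B) :
  satisfies (ops B) max_rel u -> satisfies (ops B) (trace_rel Hf) u.
Proof. apply max_rel_satisfies, trace_rel_stable. Qed.

Lemma max_rel_identities (B : algebra C) (i : idx D) (env : ivars D i -> state -> car B) :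
  (forall v, satisfies (ops B) max_rel (env v)) ->
  forall x, eval (dual_op step B) env (lhs D i) x = eval (dual_op step B) env (rhs D i) x.
Proof.
  intros Henv x. destruct (state_st x) as (S & f & Hf & s & ->).
  (* Restricted along [st Hf], the environment consists of homomorphisms from [S], for which the
     identities of [D] hold. *)
  set (envS := fun v => trace_hom (Hf := Hf) B (max_trace B (Henv v))).
  assert (H : forall (t : term SD (ivars D i)) s, eval (dual_op step B) env t (st Hf s)
            = eval (fun a g => hcomp (copair S a B g) (coop S a)) envS t s).
  { intros t.
    apply (eval_rel (dual_op step B) (fun a g => hcomp (copair S a B g) (coop S a))
             (fun u h => forall s, u (st Hf s) = h s)); [|reflexivity].
    intros a u g Hug r. simpl. rewrite dual_op_st, copair_coop.
    apply eval_ext. intros [j y]. apply Hug. }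
  rewrite !H. apply coalg_ax.
Qed.

Definition cofree : coalgebra C D := pres_coalg (proj2 max_rel_stable) max_rel_identities.

Definition counit : hom (base cofree) A := lift (proj1 max_rel_stable).

Definition class (x : state) : car (base cofree) := gen C max_rel x.

Lemma counit_class (x : state) : counit (class x) = label x.
Proof. exact (lift_gen _ (proj1 max_rel_stable) x). Qed.

Lemma cofree_hom_ext (B : algebra C) (h k : hom (base cofree) B) :
  (forall x, h (class x) = k (class x)) -> forall q, h q = k q.
Proof. apply pres_hom_ext. Qed.

Lemma coop_class (a : sym SD) (x : state) :
  coop cofree a (class x) = dual_op step (cop cofree a) a (fun i y => inj cofree a i (class y)) x.
Proof.
  etransitivity; [exact (pres_coop_gen (proj2 max_rel_stable) a x)|].
  apply eval_ext. intros [i y]. symmetry. exact (coproj_gen _ i y).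
Qed.

Lemma cofree_copair_coop (a : sym SD) (B : algebra C) (g : ari SD a -> hom (base cofree) B) x :
  copair cofree a B g (coop cofree a (class x))
  = dual_op step B a (fun i y => g i (class y)) x.
Proof. exact (cotuple_coop (proj2 max_rel_stable) a g x). Qed.

Lemma counit_respects : respects_sub cofree R' counit.
Proof.
  intros a'. set (a := proj1_sig a').
  set (k := copair cofree a (cop R' a') (fun i => hcomp (inj R' a' i) counit)).
  exists k. split.
  - intros i x. exact (copair_inj _ _ _ _ cofree a (cop R' a') _ i x).
  - apply (cofree_hom_ext (hcomp k (coop cofree a)) (hcomp (coop R' a') counit)).
    intros x. change (k (coop cofree a (class x)) = coop R' a' (counit (class x))).
    unfold k. rewrite cofree_copair_coop, counit_class.
    (* On a state traced from [S], both sides can be computed in [S], where [f] respects the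
       co-operation. *)
    destruct (state_st x) as (S & f & Hf & s & ->).
    rewrite dual_op_st.
    destruct (Hf a') as (l & Hl & Hlc).
    change (label (st Hf s)) with (f s). rewrite <- Hlc.
    etransitivity; [|symmetry; apply hom_coop].
    apply eval_ext. intros [i y]. cbn [fst snd].
    transitivity (inj R' a' i (f y)); [|symmetry; exact (Hl i y)].
    exact (f_equal (inj R' a' i) (counit_class (st Hf y))).
Qed.

(** * Universal property of the cofree coalgebra *)

Section Universal.
Variables (S : coalgebra C D) (f : hom (base S) A) (Hf : respects_sub S R' f).

Definition unfold_hom : hom (base S) (base cofree) :=
  trace_hom (Hf := Hf) (base cofree) (max_trace (base cofree) (gen_satisfies C max_rel)).

Lemma unfold_hom_mor : coalg_mor S cofree unfold_hom.
Proof.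
  intros a.
  exists (copair S a (cop cofree a) (fun i => hcomp (inj cofree a i) unfold_hom)). split.
  - intros i x. exact (copair_inj _ _ _ _ S a (cop cofree a) _ i x).
  - intros s. rewrite copair_coop. change (unfold_hom s) with (class (st Hf s)).
    rewrite coop_class, dual_op_st. reflexivity.
Qed.

Lemma counit_unfold_hom (s : car (base S)) : counit (unfold_hom s) = f s.
Proof. exact (counit_class (st Hf s)). Qed.

Lemma unfold_hom_unique (g1 g2 : hom (base S) (base cofree)) :
  coalg_mor S cofree g1 -> coalg_mor S cofree g2 ->
  (forall s, counit (g1 s) = f s) -> (forall s, counit (g2 s) = f s) ->
  forall s, g1 s = g2 s.
Proof.
  intros M1 M2 H1 H2 s.
  (* Once [max_rel] enlarged by all pairs of terms denoting [g1 s] and [g2 s] is shown stable,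
     maximality forces these values to agree. *)
  set (E := fun t1 t2 => max_rel t1 t2 \/
    exists s, eval (ops (base cofree)) class t1 = g1 s /\ eval (ops (base cofree)) class t2 = g2 s).
  assert (E_sat : forall (B : algebra C) (h : hom (base cofree) B), (forall s, h (g1 s) = h (g2 s)) ->
            satisfies (ops B) E (fun x => h (class x))).
  { intros B h Hh t1 t2 [H|(r & Hr1 & Hr2)].
    - exact (hom_gen_satisfies h t1 t2 H).
    - rewrite <- !eval_hom, Hr1, Hr2. apply Hh. }
  assert (HE : stable_rel E).
  { split.
    - replace label with (fun x => counit (class x)) by (extensionality x; apply counit_class).
      apply E_sat. intros r. now rewrite H1, H2.
    - intros B a u Hu.
      (* Since [u i] satisfies [E], it extends to a homomorphism [h i] that equalizes [g1] and [g2];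
         the induced operation must preserve this property. *)
      assert (Hu' : forall i, satisfies (ops B) max_rel (u i))
        by (intros i t1 t2 H; apply (Hu i); left; exact H).
      set (h := fun i => lift (Hu' i) : hom (base cofree) B).
      assert (h_class : forall i x, h i (class x) = u i x) by (intros i x; apply lift_gen).
      assert (h_eq : forall i r, h i (g1 r) = h i (g2 r)).
      { intros i r. destruct (gen_surj (g1 r)) as [t1 Ht1], (gen_surj (g2 r)) as [t2 Ht2].
        rewrite Ht1, Ht2, !eval_hom. rewrite !(eval_ext _ _ _ (h_class i)).
        apply (Hu i). right. exists r. auto. }
      set (h' := hcomp (copair cofree a B h) (coop cofree a)).
      replace (dual_op step B a u) with (fun x => h' (class x)).
      + apply E_sat. intros r.
        change (copair cofree a B h (coop cofree a (g1 r))
                = copair cofree a B h (coop cofree a (g2 r))).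
        (* As [g1] and [g2] respect [a], both sides become homomorphisms out of the copower of [S],
           compared on coprojections by [h_eq]. *)
        destruct (M1 a) as (k1 & Hi1 & Hc1), (M2 a) as (k2 & Hi2 & Hc2).
        rewrite <- Hc1, <- Hc2. set (cp := copair cofree a B h).
        change (hcomp cp k1 (coop S a r) = hcomp cp k2 (coop S a r)).
        rewrite !hom_coop. apply eval_ext. intros [i y]. cbn [fst snd].
        transitivity (cp (inj cofree a i (g1 y))); [exact (f_equal cp (Hi1 i y))|].
        transitivity (cp (inj cofree a i (g2 y))); [|exact (eq_sym (f_equal cp (Hi2 i y)))].
        unfold cp. rewrite !copair_inj. apply h_eq.
      + extensionality x. etransitivity; [exact (cofree_copair_coop a h x)|].
        apply eval_ext. intros [i y]. apply h_class. }
  destruct (gen_surj (g1 s)) as [t1 Ht1], (gen_surj (g2 s)) as [t2 Ht2].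
  rewrite Ht1, Ht2. apply gen_satisfies. exists E. split; [exact HE|].
  right. exists s. auto.
Qed.

End Universal.

Lemma cofree_universal :
  exists (R : coalgebra C D) (e : hom (base R) (base R')),
    respects_sub R R' e /\
    forall (S : coalgebra C D) (f : hom (base S) (base R')),
      respects_sub S R' f ->
      exists g : hom (base S) (base R),
        coalg_mor S R g /\ (forall x, e (g x) = f x) /\
        (forall g' : hom (base S) (base R),
           coalg_mor S R g' -> (forall x, e (g' x) = f x) ->
           forall x, g' x = g x).
Proof.
  exists cofree, counit. split; [exact counit_respects|]. intros S f Hf.
  exists (unfold_hom Hf). split; [apply unfold_hom_mor|].
  split; [apply counit_unfold_hom|]. intros g' M He.
  apply (unfold_hom_unique f); auto using unfold_hom_mor, counit_unfold_hom.
Qed.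
End Cofree.

Unset Implicit Arguments.

Theorem theorem4p9 (SC : signature) (C : theory SC) (SD : signature) (D : theory SD) :
  (* (1) the forgetful functor Coalg(C,D) -> C has a right adjoint:
         a universal arrow from the forgetful functor to each C-algebra A *)
  (forall A : algebra C,
     exists (R : coalgebra C D) (e : hom (base R) A),
       forall (S : coalgebra C D) (f : hom (base S) A),
         exists g : hom (base S) (base R),
           coalg_mor S R g /\ (forall x, e (g x) = f x) /\
           (forall g' : hom (base S) (base R),
              coalg_mor S R g' -> (forall x, e (g' x) = f x) ->
              forall x, g' x = g x))
  /\
  (* (2) for D' with operation symbols a subset of those of D (arities
         restricted, arbitrary identities) and any D'-coalgebra R' *)
  (forall (P : sym SD -> Prop) (D' : theory (sub_sig SD P)) (R' : coalgebra C D'),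
     exists (R : coalgebra C D) (e : hom (base R) (base R')),
       respects_sub R R' e /\
       forall (S : coalgebra C D) (f : hom (base S) (base R')),
         respects_sub S R' f ->
         exists g : hom (base S) (base R),
           coalg_mor S R g /\ (forall x, e (g x) = f x) /\
           (forall g' : hom (base S) (base R),
              coalg_mor S R g' -> (forall x, e (g' x) = f x) ->
              forall x, g' x = g x)).

Proof.
  split; [intros A | intros P D' R'; apply cofree_universal].
  (* With neither operation symbols nor identities, a coalgebra is just an algebra and every
     homomorphism respects the structure, so the absolute statement is a case of the relative
     one. *)
  set (none := fun _ : sym SD => False).
  set (D0 := @Theory (sub_sig SD none) Empty_set (fun e => match e return Type with end)
               (fun e => match e with end) (fun e => match e with end)).
  set (R0 := Coalgebra SC C (sub_sig SD none) D0 A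
    (fun a => match proj2_sig a with end) (fun a => match proj2_sig a with end)
    (fun a => match proj2_sig a with end) (fun a => match proj2_sig a with end)
    (fun a => match proj2_sig a with end) (fun a => match proj2_sig a with end)
    (fun B i => match i with end)).
  destruct (cofree_universal (D := D) R0) as (R & e & _ & U). exists R, e.
  intros S f. apply U. intros [a []].
Qed.
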